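(* Let $G=(V,E)$ be a graph. Then, for every integer $k$ with $1\le k\le |V|$, \[ \sum_{i=1}^k \lambda_i(L(G))\le |E|+k\cdot \nu(G)+\left\lfloor\frac{k}{2}\right\rfloor . \]
   Context: Graphs are finite, simple and undirected, with non-empty vertex set. The Laplacian matrix $L(G)$ of $G=(V,E)$ is the $|V|\times|V|$ matrix with $L(G)_{u,u}=\deg(u)$, $L(G)_{u,v}=-1$ if $\{u,v\}\in E$, and $L(G)_{u,v}=0$ otherwise. For $1\le i\le |V|$, $\lambda_i(L(G))$ denotes the $i$-th largest eigenvalue of $L(G)$ (counted with multiplicity). The matching number $\nu(G)$ is the maximum size of a set of pairwise disjoint edges of $G$. *)

(* Defs.v *)
From HB Require Import structures.
From mathcomp Require Import all_boot all_order all_algebra.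
From mathcomp Require Import polyrcf complex.
From mathcomp Require Import reals.

Set Implicit Arguments.
Unset Strict Implicit.
Unset Printing Implicit Defensive.

Import Order.TTheory GRing.Theory Num.Theory.

Local Open Scope ring_scope.

Section Graph.

(* A simple graph on the vertex type V is given by its adjacency relation e,
   assumed symmetric and irreflexive in the statements about it. *)
Variables (V : finType) (e : rel V).

Definition deg (u : V) : nat := #|[set v | e u v]|.

Definition edges : {set {set V}} :=
  [set f | [exists u, exists v, e u v && (f == [set u; v])]].

Definition matching (M : {set {set V}}) : bool :=
  (M \subset edges) && trivIset M.

Definition matching_number : nat :=
  (\max_(M : {set {set V}} | matching M) #|M|)%N.

(* Matrices are indexed by ordinals: row and column i stand for the vertex
   enum_val i. *)
Definition laplacian (R : pzRingType) : 'M[R]_#|V| :=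
  \matrix_(i, j)
    let u := enum_val i in let v := enum_val j in
    if u == v then (deg u)%:R else if e u v then -1 else 0.

End Graph.

Lemma char_poly_similar (F : fieldType) (n : nat) (P D : 'M[F]_n) :
  P \in unitmx -> char_poly (invmx P *m D *m P) = char_poly D.
Proof.
move=> uP; pose Q := map_mx polyC P; pose Q' := map_mx polyC (invmx P).
have Q'Q : Q' *m Q = 1%:M by rewrite -map_mxM mulVmx // map_mx1.
suff: char_poly_mx (invmx P *m D *m P) = Q' *m char_poly_mx D *m Q.
  by move=> E; rewrite /char_poly E !det_mulmx mulrAC -det_mulmx Q'Q det1 mul1r.
rewrite /char_poly_mx mulmxBr mulmxBl !map_mxM; congr (_ - _).
by rewrite scalar_mxC -mulmxA Q'Q mulmx1.
Qed.

Section Eigenvalues.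

Variables (R : rcfType) (n : nat).
Implicit Types A : 'M[R]_n.

(* The roots in R of the characteristic polynomial, each repeated according to
   its multiplicity, in nonincreasing order. When A is symmetric this is the
   whole spectrum: see char_poly_spectrum and size_spectrum below. *)
Definition spectrum A : seq R :=
  sort >=%R
    (flatten [seq nseq (mup x (char_poly A)) x | x <- rootsR (char_poly A)]).

(* The i-th largest eigenvalue, numbered from 1. *)
Definition lambda A (i : nat) : R := (spectrum A)`_i.-1.

Lemma perm_spectrum A (s : seq R) :
  char_poly A = \prod_(x <- s) ('X - x%:P) -> perm_eq (spectrum A) s.
Proof.
move=> As; rewrite perm_sort; apply/allP => x _ /=; apply/eqP.
have A0 : char_poly A != 0 by rewrite monic_neq0 ?char_poly_monic.
have -> : count_mem x s = mup x (char_poly A) by rewrite As mu_prod_XsubC.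
rewrite count_flatten -map_comp sumnE big_map.
have [xr|xr] := boolP (x \in rootsR (char_poly A)).
  rewrite (bigD1_seq x) //= ?uniq_roots // count_nseq /= eqxx mul1n.
  rewrite big1 ?addn0 // => y /negPf yx.
  by rewrite count_nseq /= yx mul0n.
rewrite big1_seq => [|y /= yr]; last first.
  rewrite count_nseq /=; case: eqP => // yx.
  by move: xr; rewrite -yx yr.
have := roots_on_rootsR A0 x; rewrite in_itv /= (negPf xr) => rx.
by rewrite mupNroot // rx.
Qed.

Lemma char_poly_spectrum A :
  A^T = A -> char_poly A = \prod_(x <- spectrum A) ('X - x%:P).
Proof.
move=> Asym; pose f := real_complex R; pose B : 'M[R[i]]_n := map_mx f A.
have fconj x : (f x)^* = f x by rewrite conj_Creal // complex_real.
have Bherm : B \is hermsymmx.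
  apply/is_hermitianmxP; rewrite expr0 scale1r.
  by apply/matrixP => i j; rewrite !mxE fconj -[in LHS]Asym mxE.
have Dreal := hermitian_spectral_diag_real Bherm.
have /hermitian_normalmx/orthomx_spectralP BE := Bherm.
pose s := [seq complex.Re (spectral_diag B 0 i) | i <- enum 'I_n].
suff As : char_poly A = \prod_(x <- s) ('X - x%:P).
  by rewrite {1}As; apply/perm_big; rewrite perm_sym perm_spectrum.
apply: (map_poly_inj f); rewrite map_char_poly -/B {1}BE char_poly_similar;
  last exact: spectral_unit.
rewrite char_poly_trig ?is_diag_mx_is_trig ?diag_mx_is_diag //.
rewrite rmorph_prod big_map big_enum /=; apply: eq_bigr => i _.
rewrite map_polyXsubC mxE eqxx mulr1n; congr ('X - _%:P).
by apply/esym/RRe_real/(mxOverP Dreal).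
Qed.

Lemma size_spectrum A : A^T = A -> size (spectrum A) = n.
Proof.
move=> /char_poly_spectrum/(congr1 (fun p : {poly R} => size p)).
by rewrite size_char_poly size_prod_XsubC => -[].
Qed.

End Eigenvalues.

Lemma trmx_laplacian (V : finType) (e : rel V) (R : pzRingType) :
  symmetric e -> (laplacian e R)^T = laplacian e R.
Proof.
move=> e_sym; apply/matrixP => i j; rewrite !mxE /= eq_sym e_sym.
by case: eqP => // ->.
Qed.

(* Main.v *)
(* By Ky Fan's principle the sum of the k largest eigenvalues is the trace of L
   compressed to k orthonormal vectors, so it is enough to bound that trace for
   an arbitrary orthonormal family; such bounds add up over edge decompositions.

   Induct on the matching number nu. If deleting some vertex v lowers nu, split
   off the star at v, which contributes at most deg v + k. Otherwise every
   vertex is missed by some maximum matching; by Gallai's lemma, "no maximum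
   matching misses both u and v" is then an equivalence relation, it contains
   the edges, and its classes have at most N = 2 nu + 1 vertices. Comparing with
   the disjoint union of cliques on the classes bounds the trace by k N, while
   Bessel's inequality bounds it by tr L = 2|E|. The minimum of these two
   integers is at most floor((k N + 2|E|) / 2) = |E| + k nu + floor(k / 2). *)
Require Import Defs.
From mathcomp Require Import all_boot all_order all_algebra.
From mathcomp Require Import fingroup.perm.
From mathcomp Require Import polyrcf complex.
From mathcomp Require Import reals.
From mathcomp Require Import ring lra zify.
Import Order.TTheory GRing.Theory Num.Theory.
Local Open Scope ring_scope.

Set Implicit Arguments.
Unset Strict Implicit.
Unset Printing Implicit Defensive.

(** * Maximum matchings and Gallai's lemma *)

Definition max_matching {V : finType} (e : rel V) (M : {set {set V}}) : bool :=
  matching e M && (#|M| == matching_number e).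

(** The vertex [v] stays in [V] as an isolated vertex, so all graphs of the induction share one
    vertex type. *)
Definition del_vertex {V : finType} (e : rel V) (v : V) : rel V :=
  fun x y => [&& e x y, x != v & y != v].

(** Taking [u = v] expresses that a single vertex is missed by some maximum matching. *)
Definition avoidable {V : finType} (e : rel V) (u v : V) : bool :=
  [exists M, [&& max_matching e M, u \notin cover M & v \notin cover M]].

Section Matchings.

Variables (V : finType) (e : rel V).
Implicit Types (M N : {set {set V}}) (f g : {set V}) (u v x y t : V).

Lemma edgesP f : reflect (exists u v, e u v /\ f = [set u; v]) (f \in edges e).
Proof.
rewrite inE; apply: (iffP existsP) => [[u /existsP [v /andP [uv /eqP ->]]]|].
  by exists u, v.
by move=> [u [v [uv ->]]]; exists u; apply/existsP; exists v; rewrite uv eqxx.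
Qed.

Lemma matching_card_le M : matching e M -> (#|M| <= matching_number e)%N.
Proof. exact: (@leq_bigmax_cond _ (matching e) (fun M => #|M|)). Qed.

Lemma max_matching_ex : exists M, max_matching e M.
Proof.
have m0 : matching e set0.
  by rewrite /matching sub0set; apply/trivIsetP => A B; rewrite inE.
have [|M mM eM] := @eq_bigmax_cond _ (matching e) (fun M => #|M|).
  by apply/card_gt0P; exists set0.
by exists M; rewrite /max_matching; apply/andP; split=> //; rewrite -eM.
Qed.

Lemma matching_inj M f g x :
  matching e M -> f \in M -> g \in M -> x \in f -> x \in g -> f = g.
Proof.
move=> /andP [_ tM] fM gM xf xg.
by rewrite -(def_pblock tM fM xf) (def_pblock tM gM xg).
Qed.

Lemma matching_setU1 M f :
  matching e M -> f \in edges e -> [disjoint f & cover M] ->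
  matching e (f |: M) /\ #|f |: M| = #|M|.+1.
Proof.
move=> /andP [sM tM] fe fM.
have [u [v [_ fuv]]] := edgesP _ fe.
have uf : u \in f by rewrite fuv set21.
split.
  rewrite /matching subUset sub1set fe sM /=.
  by apply: trivIsetU; rewrite ?trivIset1 ?cover1.
rewrite cardsU1; case: (boolP (f \in M)) => // fM'.
move: fM => /disjointFr /(_ uf) /negP []; apply/bigcupP; by exists f.
Qed.

Lemma matchingS M N : N \subset M -> matching e M -> matching e N.
Proof.
move=> NM /andP [sM tM].
by rewrite /matching (subset_trans NM sM) (trivIsetS NM tM).
Qed.

Hypothesis e_irr : irreflexive e.

Lemma card_edge f : f \in edges e -> #|f| = 2%N.
Proof.
move=> /edgesP [u [v [uv ->]]]; rewrite cards2.
by case: eqP uv => // ->; rewrite e_irr.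
Qed.

Lemma card_cover_matching M : matching e M -> #|cover M| = (2 * #|M|)%N.
Proof.
move=> /andP [/subsetP sM].
have /leqifP := leq_card_cover M => + tM; rewrite tM => /eqP ->.
rewrite (eq_bigr (fun=> 2%N)) => [|f /sM /card_edge //].
by rewrite sum_nat_const mulnC.
Qed.

Lemma edge_not_avoidable u v : e u v -> ~~ avoidable e u v.
Proof.
move=> uv; apply/existsPn => M; apply/negP => /and3P [/andP [mM /eqP cM] uM vM].
have [| |mM' cM'] := @matching_setU1 M [set u; v] mM.
- by apply/edgesP; exists u, v.
- rewrite disjoint_subset; apply/subsetP => x.
  by rewrite !inE => /orP [] /eqP ->.
by move: (matching_card_le mM'); rewrite cM' cM ltnn.
Qed.

(* Exchange argument: if M is a maximum matching missing u and v, then among the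
   maximum matchings missing t the one sharing most edges with M cannot cover
   both u and v, since otherwise one of its edges can be traded for one of M. *)
Lemma avoidable_trans u v t :
  u != v -> avoidable e u v -> avoidable e t t ->
  avoidable e t u || avoidable e t v.
Proof.
move=> uv /existsP [M /and3P [/andP [mM /eqP cM] uM vM]].
move=> /existsP [N0 /and3P [mN0 tN0 _]].
pose P N := max_matching e N && (t \notin cover N).
have P0 : P N0 by rewrite /P mN0.
case: (arg_maxnP (fun N => #|M :&: N|) P0) => N /andP [xN tN] Nmax.
have /andP [mN /eqP cN] := xN.
have [uN|uN] := boolP (u \in cover N); last first.
  by apply/orP; left; apply/existsP; exists N; rewrite xN tN uN.
have [vN|vN] := boolP (v \in cover N); last first.
  by apply/orP; right; apply/existsP; exists N; rewrite xN tN vN.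
exfalso.
(* Both covers have 2 nu vertices and [N] covers [u] and [v], which [M] misses. So [M] covers at
   least two vertices missed by [N], and one of them, [x], differs from [t]. *)
have le2 : (2 <= #|cover N :\: cover M|)%N.
  have <- : #|[set u; v]| = 2%N by rewrite cards2 uv.
  apply: subset_leq_card; apply/subsetP => z.
  by rewrite !inE => /orP [] /eqP ->; rewrite ?uM ?vM ?uN ?vN.
have eqD : #|cover M :\: cover N| = #|cover N :\: cover M|.
  by rewrite !cardsD !card_cover_matching // cM cN setIC.
have /card_gt0P [x] : (0 < #|(cover M :\: cover N) :\ t|)%N.
  have := leq_b1 (t \in cover M :\: cover N).
  by have := cardsD1 t (cover M :\: cover N); lia.
rewrite !inE => /and3P [xt xN' /bigcupP [f fM xf]].
have fe : f \in edges e by case/andP: mM => /subsetP /(_ _ fM).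
have [y yf ey] : exists2 y, y \in f & f = [set x; y].
  have := fe; case/edgesP => a [b [_ fab]]; move: xf; rewrite fab !inE.
  by case/orP => /eqP ->; [exists b|exists a]; rewrite ?set21 ?set22 // setUC.
have yN : y \in cover N.
  apply: contraT => yN; have [| |mN' cN'] := @matching_setU1 N f mN.
  - exact: fe.
  - rewrite disjoint_subset; apply/subsetP => z.
    by rewrite ey !inE => /orP [] /eqP ->.
  by move: (matching_card_le mN'); rewrite cN' cN ltnn.
have /bigcupP [g gN yg] := yN.
have fN : f \notin N by apply: contra xN' => fN; apply/bigcupP; exists f.
have xg : x \notin g by apply: contra xN' => xg; apply/bigcupP; exists g.
have gM : g \notin M.
  apply: contra xg => gM.
  by rewrite -(matching_inj mM fM gM yf yg).
have coverNg z : z \in cover (N :\ g) -> z \in cover N.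
  by case/bigcupP => h /setD1P [_ hN] zh; apply/bigcupP; exists h.
have yNg : y \notin cover (N :\ g).
  apply/negP => /bigcupP [h /setD1P [/eqP hg hN] yh]; apply: hg.
  exact: (matching_inj mN hN gN yh yg).
(* Trading [g] for [f] keeps the size, and [t] stays missed because [x != t] and [y], unlike [t], is
   covered by [N]. The edge [f] of [M] is gained and no edge of [M] is lost. *)
have [| | |mN' cN'] := @matching_setU1 (N :\ g) f.
- exact: (matchingS (subD1set N g) mN).
- exact: fe.
- rewrite disjoint_subset; apply/subsetP => z.
  rewrite ey !inE => /orP [] /eqP -> //.
  by apply: contra xN' => /coverNg.
have PN' : P (f |: (N :\ g)).
  rewrite /P /max_matching mN' cN' -cN (cardsD1 g N) gN eqxx /=.
  apply/negP => /bigcupP [h /setU1P [->|/setD1P [_ hN]] th].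
    move: th; rewrite ey !inE eq_sym (negPf xt) /= => /eqP ty.
    by rewrite ty yN in tN.
  by case/negP: tN; apply/bigcupP; exists h.
have := Nmax _ PN'; apply/negP; rewrite -ltnNge.
apply: (@leq_trans #|f |: (M :&: N)|).
  by rewrite cardsU1 inE (negPf fN) andbF.
apply: subset_leq_card; apply/subsetP => h; rewrite !inE.
case: eqP => [-> _|_ /= /andP [hM hN]]; first by rewrite fM.
by rewrite hM hN andbT; apply: contra gM => /eqP <-.
Qed.

Hypothesis all_missed : forall v, avoidable e v v.

(** The disjunct [u == v] secures reflexivity: a vertex missed by some maximum matching is
    [avoidable] with itself. *)
Definition gallai_rel : rel V := fun u v => (u == v) || ~~ avoidable e u v.

Lemma avoidable_sym : symmetric (avoidable e).
Proof.
by move=> u v; apply/existsP/existsP => -[M /and3P [? ? ?]]; exists M; apply/and3P.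
Qed.

(** Transitivity is the contrapositive of [avoidable_trans], with [all_missed] applied to the middle
    vertex. *)
Lemma gallai_rel_equiv : equivalence_rel gallai_rel.
Proof.
have S : symmetric gallai_rel.
  by move=> u v; rewrite /gallai_rel eq_sym avoidable_sym.
have T : transitive gallai_rel.
  move=> t u v; rewrite /gallai_rel; case: eqP => [-> //|_ /= ut].
  case: eqP => [<- _|_ /= tv]; first by rewrite ut orbT.
  case: eqVneq => //= uv; apply/negP => auv.
  have := avoidable_trans uv auv (all_missed t).
  by rewrite (negPf tv) avoidable_sym (negPf ut).
apply/equivalence_relP; split=> [u|u v uv z]; first by rewrite /gallai_rel eqxx.
by apply/idP/idP; apply: T; rewrite // S.
Qed.

(** A maximum matching covers 2 nu vertices and misses at most one vertex of the class, since two
    distinct missed vertices would be [avoidable] together. *)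
Lemma gallai_class_card u :
  (#|[set v | gallai_rel u v]| <= (2 * matching_number e).+1)%N.
Proof.
have [M /[dup] xM /andP [mM /eqP cM]] := max_matching_ex.
rewrite -cM -card_cover_matching // -addn1.
set C := [set v | _]; rewrite -(cardsID (cover M) C).
apply: leq_add; first exact/subset_leq_card/subsetIr.
apply/card_le1_eqP => x y; rewrite !inE => /andP [xM' ux] /andP [yM' uy].
have : gallai_rel x y.
  by have [_ /(_ ux) <-] := gallai_rel_equiv u x y.
case/orP => [/eqP //|/existsPn /(_ M)]; by rewrite xM xM' yM'.
Qed.

End Matchings.

(** * Edge counts and deletion of a vertex *)

Section Counting.
Variables (V : finType) (e : rel V).
Hypotheses (e_sym : symmetric e) (e_irr : irreflexive e).

Lemma handshake : (\sum_u \sum_v e u v = 2 * #|edges e|)%N.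
Proof.
rewrite pair_big /= (eq_bigr (fun p => if e p.1 p.2 then 1 else 0)%N); last first.
  by move=> p _; case: (e _ _).
rewrite -big_mkcond /= (partition_big (fun p => [set p.1; p.2]) (mem (edges e))) /=.
  rewrite (eq_bigr (fun=> 2%N)) ?sum_nat_const 1?mulnC // => f.
  case/edgesP => a [b [ab ->]].
  have neq_ab : a != b by apply: contraTneq ab => ->; rewrite e_irr.
  rewrite sum1dep_card.
  have -> : [set x | e x.1 x.2 & [set x.1; x.2] == [set a; b]]
             = [set (a, b); (b, a)].
    apply/setP => -[x y]; rewrite !inE /= !xpair_eqE.
    apply/andP/idP => [[xy /eqP xyab]|].
      have xab : x \in [set a; b] by rewrite -xyab set21.
      have yab : y \in [set a; b] by rewrite -xyab set22.
      move: xy; case/set2P: xab => ->; case/set2P: yab => ->;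
        by rewrite ?e_irr // !eqxx ?orbT.
    by case/orP => /andP [/eqP -> /eqP ->]; rewrite ?ab // e_sym ab setUC.
  by rewrite cards2 xpair_eqE (negPf neq_ab).
by move=> [a b] /= ab; apply/edgesP; exists a, b.
Qed.

Lemma del_vertex_sym v : symmetric (del_vertex e v).
Proof. by move=> x y; rewrite /del_vertex e_sym; congr andb; rewrite andbC. Qed.

Lemma del_vertex_irr v : irreflexive (del_vertex e v).
Proof. by move=> x; rewrite /del_vertex e_irr. Qed.

Lemma edges_del_vertex v :
  (#|edges (del_vertex e v)| + #|[set u | e v u]| <= #|edges e|)%N.
Proof.
have inj : {in [set u | e v u] &, injective (fun u => [set v; u])}.
  move=> u w; rewrite !inE => vu vw uw; have : u \in [set v; w].
    by rewrite -uw set22.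
  by case/set2P => // uv; move: vu; rewrite uv e_irr.
rewrite -(card_in_imset inj); set B := imset _ _.
have disj : [disjoint edges (del_vertex e v) & B].
  rewrite disjoint_subset; apply/subsetP => f /edgesP [x [y [/and3P [_ xv yv] ->]]].
  rewrite inE; apply/imsetP => -[u _] xyvu; have : v \in [set x; y].
    by rewrite xyvu set21.
  by rewrite !inE ![v == _]eq_sym (negPf xv) (negPf yv).
have /leqifP := leq_card_setU (edges (del_vertex e v)) B.
rewrite disj => /eqP <-; apply: subset_leq_card; apply/subsetP => f.
case/setUP => [/edgesP [x [y [/and3P [xy _ _] ->]]]|/imsetP [u vu ->]].
  by apply/edgesP; exists x, y.
by apply/edgesP; exists v, u; rewrite inE in vu.
Qed.

Lemma del_vertex_matching v M :
  matching (del_vertex e v) M = matching e M && (v \notin cover M).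
Proof.
rewrite /matching andbAC; congr andb; apply/subsetP/andP => [sM|[/subsetP sM vM] f fM].
  split.
    apply/subsetP => f /sM /edgesP [x [y [/and3P [xy _ _] ->]]].
    by apply/edgesP; exists x, y.
  apply/negP => /bigcupP [f /sM /edgesP [x [y [/and3P [xy xv yv] ->]]]].
  by rewrite !inE ![v == _]eq_sym (negPf xv) (negPf yv).
have /edgesP [x [y [xy fxy]]] := sM _ fM; apply/edgesP; exists x, y; split=> //.
have vf : v \notin f by apply: contra vM => vf; apply/bigcupP; exists f.
by move: vf; rewrite fxy !inE negb_or /del_vertex xy ![_ == v]eq_sym.
Qed.

(** A maximum matching of the graph without [v] is a matching of [e] missing [v]; if nu did not
    drop, it is maximum in [e] as well. *)
Lemma del_vertex_avoidable v :
  (matching_number e <= matching_number (del_vertex e v))%N -> avoidable e v v.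
Proof.
move=> le; have [M /andP [mM /eqP cM]] := max_matching_ex (del_vertex e v).
move: mM; rewrite del_vertex_matching => /andP [mM vM].
apply/existsP; exists M; rewrite vM andbT andbT /max_matching mM eqn_leq.
by rewrite matching_card_le // cM le.
Qed.

End Counting.

(** * Quadratic forms of stars, cliques and vertex deletions *)

(** The sum runs over ordered pairs, so for a symmetric irreflexive [e] this is twice the Laplacian
    quadratic form; hence the factors 2 below. *)
Definition energy {R : pzRingType} {V : finType} (e : rel V) (x : V -> R) : R :=
  \sum_u \sum_v (e u v)%:R * (x u - x v) ^+ 2.

(* y stands for the real and imaginary parts of k orthonormal vectors; the
   second condition is Bessel's inequality. *)
Definition bessel_family {R : numDomainType} {V I : finType} (k : nat)
    (y : I -> V -> R) : Prop :=
  \sum_i \sum_v y i v ^+ 2 = k%:R /\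
  forall b : V -> R, \sum_i (\sum_v y i v * b v) ^+ 2 <= \sum_v b v ^+ 2.

Section Energy.
Variables (R : realFieldType) (V : finType).
Implicit Types (e : rel V) (x : V -> R) (A : {set V}).

Definition star_vector A (v u : V) : R :=
  if u == v then #|A|%:R else if u \in A then -1 else 0.

Lemma sum_star_vector A v (F : V -> R -> R) :
  v \notin A -> (forall u, F u 0 = 0) ->
  \sum_u F u (star_vector A v u) = F v #|A|%:R + \sum_(u in A) F u (-1).
Proof.
move=> vA F0; rewrite (bigD1 v) //= {1}/star_vector eqxx; congr (_ + _).
rewrite [RHS]big_mkcond [RHS](bigD1 v) //= (negPf vA) add0r.
apply: eq_bigr => u uv; rewrite /star_vector (negPf uv).
by case: ifP => // _; rewrite F0.
Qed.

(* The Laplacian of a star with d leaves is at most the identity plus a rank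
   one matrix, proportional to the top eigenvector (d, -1, ..., -1). *)
Lemma star_energy A v x : v \notin A ->
  \sum_(u in A) (x u - x v) ^+ 2 <=
    \sum_u x u ^+ 2
    + (\sum_u x u * star_vector A v u) ^+ 2 / (#|A|%:R + 1).
Proof.
move=> vA; set d : R := #|A|%:R.
have d0 : 0 < d + 1 by rewrite ltr_wpDl ?ler0n.
rewrite (sum_star_vector (F := fun u c => x u * c) vA) //; last first.
  by move=> u; rewrite mulr0.
rewrite -mulr_suml -/d mulrN1; set s := \sum_(u in A) x u.
have -> : \sum_(u in A) (x u - x v) ^+ 2
            = \sum_(u in A) x u ^+ 2 - 2 * x v * s + d * x v ^+ 2.
  have -> : d * x v ^+ 2 = \sum_(u in A) x v ^+ 2.
    by rewrite sumr_const -mulr_natl.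
  rewrite /s mulr_sumr -sumrB -big_split /=; apply: eq_bigr => u _; ring.
set q := \sum_(u in A) _.
have qle : x v ^+ 2 + q <= \sum_u x u ^+ 2.
  rewrite (bigD1 v) //= lerD2l /q big_mkcond [leLHS](bigD1 v) //= (negPf vA).
  by rewrite add0r; apply: ler_sum => u _; case: ifP => // _; rewrite sqr_ge0.
(* The gap is this square, the component of [x] along the constant vector on the star, plus the
   squares of [x] outside the star. *)
rewrite -subr_ge0; apply: le_trans (_ : (x v + s) ^+ 2 / (d + 1) <= _).
  by rewrite divr_ge0 ?sqr_ge0 // ltW.
rewrite -subr_ge0.
set T := \sum_u _ in qle *.
have -> : T + (x v * d - s) ^+ 2 / (d + 1)
       - (q - 2 * x v * s + d * x v ^+ 2) - (x v + s) ^+ 2 / (d + 1)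
     = T - (x v ^+ 2 + q) by field; rewrite gt_eqF.
by rewrite subr_ge0.
Qed.

(** The relation [c u == c v] is a disjoint union of cliques, with loops that contribute zero. After
    expanding the square, each of the two diagonal sums is at most [n] times the squared norm, and
    the subtracted cross term is a sum of squares of class sums. *)
Lemma cut_energy (T : finType) (c : V -> T) (n : nat) x :
  (forall u, (#|[set v | c u == c v]| <= n)%N) ->
  \sum_u \sum_v (c u == c v)%:R * (x u - x v) ^+ 2 <= 2 * n%:R * \sum_u x u ^+ 2.
Proof.
move=> cn.
have cross : 0 <= \sum_u \sum_v (c u == c v)%:R * (x u * x v).
  rewrite (partition_big c predT) //=; apply: sumr_ge0 => t _.
  rewrite (_ : \sum_(u | _) _ = (\sum_(u | c u == t) x u) ^+ 2) ?sqr_ge0 //.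
  rewrite expr2 mulr_suml; apply: eq_bigr => u /eqP cu.
  rewrite mulr_sumr [RHS]big_mkcond /=; apply: eq_bigr => v _.
  by rewrite cu eq_sym; case: eqP; rewrite ?mul1r ?mul0r.
have diag : \sum_u \sum_v (c u == c v)%:R * x u ^+ 2 <= n%:R * \sum_u x u ^+ 2.
  rewrite mulr_sumr; apply: ler_sum => u _.
  rewrite -mulr_suml; apply: ler_wpM2r; first exact: sqr_ge0.
  rewrite -natr_sum ler_nat; apply: leq_trans (cn u).
  rewrite -sum1dep_card [leqRHS]big_mkcond /=.
  by apply: leq_sum => v _; case: eqP.
have -> : \sum_u \sum_v (c u == c v)%:R * (x u - x v) ^+ 2
  = \sum_u \sum_v (c u == c v)%:R * x u ^+ 2
    + \sum_u \sum_v (c u == c v)%:R * x u ^+ 2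
    - 2 * \sum_u \sum_v (c u == c v)%:R * (x u * x v).
  rewrite [X in _ = _ + X - _]exchange_big /= mulr_sumr -big_split -sumrB /=.
  apply: eq_bigr => u _; rewrite mulr_sumr -big_split -sumrB /=.
  apply: eq_bigr => v _; rewrite [c v == c u]eq_sym; ring.
lra.
Qed.

Lemma energy_le e (e' : rel V) x : subrel e e' -> energy e x <= energy e' x.
Proof.
move=> ee'; apply: ler_sum => u _; apply: ler_sum => v _.
apply: ler_wpM2r; first exact: sqr_ge0.
by rewrite ler_nat; case: (e u v) (ee' u v) => // ->.
Qed.

Lemma energy_del_vertex e v x : symmetric e -> irreflexive e ->
  energy e x = energy (del_vertex e v) x
               + 2 * \sum_(u in [set u | e v u]) (x u - x v) ^+ 2.
Proof.
move=> e_sym e_irr; pose F u w := (e u w)%:R * (x u - x w) ^+ 2.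
set S := \sum_(u in _) _.
have SF : S = \sum_w F v w.
  rewrite /S /F big_mkcond /=; apply: eq_bigr => u _; rewrite inE.
  by case: (e v u); rewrite ?mul1r ?mul0r // -sqrrN opprB.
have F0 : F v v = 0 by rewrite /F e_irr mul0r.
have Fsym u w : F u w = F w u by rewrite /F e_sym -sqrrN opprB.
have -> : energy (del_vertex e v) x = \sum_(u | u != v) \sum_(w | w != v) F u w.
  rewrite /energy [RHS]big_mkcond; apply: eq_bigr => u _ /=.
  case: (eqVneq u v) => [->|uv].
    by rewrite big1 // => w _; rewrite /del_vertex eqxx andbF mul0r.
  rewrite [RHS]big_mkcond; apply: eq_bigr => w _; rewrite /del_vertex uv /=.
  by case: ifP; rewrite ?andbT // andbF mul0r.
have -> : energy e x = \sum_w F v w + \sum_(u | u != v) \sum_w F u w.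
  by rewrite /energy (bigD1 v).
rewrite [X in _ + X](eq_bigr (fun u => F u v + \sum_(w | w != v) F u w)); last first.
  by move=> u _; rewrite (bigD1 v).
rewrite big_split /=.
have -> : \sum_(u | u != v) F u v = S.
  rewrite SF [RHS](bigD1 v) //= F0 add0r; apply: eq_bigr => u _; exact: Fsym.
rewrite -SF; ring.
Qed.

End Energy.

(** * Energy bounds for Bessel families *)

Section BesselFamily.
Variables (R : realFieldType) (V I : finType) (k : nat) (y : I -> V -> R).
Hypothesis yB : bessel_family k y.

(** In the sum of [star_energy] over the family, the norms give [k]; Bessel at the star vector, of
    squared norm [d (d + 1)] with [d = #|A|], gives [d]. *)
Lemma bessel_star (A : {set V}) v : v \notin A ->
  \sum_i \sum_(u in A) (y i u - y i v) ^+ 2 <= #|A|%:R + k%:R.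
Proof.
move=> vA; have [<- yb] := yB.
apply: le_trans (ler_sum _ (fun i _ => star_energy (y i) vA)) _.
rewrite big_split /= addrC lerD2r -mulr_suml.
have d0 : 0 < #|A|%:R + 1 :> R by rewrite ltr_wpDl ?ler0n.
rewrite ler_pdivrMr //; apply: le_trans (yb _) _.
rewrite (sum_star_vector (F := fun u c => c ^+ 2) vA) //; last first.
  by move=> u; rewrite expr0n.
by rewrite sqrrN expr1n sumr_const mulrDr mulr1 expr2.
Qed.

Lemma bessel_edge u v : u != v -> \sum_i (y i u - y i v) ^+ 2 <= 2.
Proof.
move=> uv; have [_ /(_ (fun w => (w == u)%:R - (w == v)%:R))] := yB.
have S (F : V -> R) w : \sum_z F z * (z == w)%:R = F w.
  rewrite (bigD1 w) //= eqxx mulr1 big1 ?addr0 // => z /negPf ->.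
  by rewrite mulr0.
rewrite (eq_bigr (fun i => (y i u - y i v) ^+ 2)) => [|i _]; last first.
  congr (_ ^+ 2); rewrite -[in RHS](S (y i) u) -[in RHS](S (y i) v) -sumrB.
  by apply: eq_bigr => w _; rewrite mulrBr.
move=> /le_trans; apply.
rewrite (eq_bigr (fun w => 1 * (w == u)%:R + 1 * (w == v)%:R)) => [|w _].
  by rewrite big_split /= !S; lra.
have [->|_] := eqVneq w u; first by rewrite (negPf uv) /=; ring.
by case: eqP => _ /=; ring.
Qed.

Lemma bessel_energy (e : rel V) : symmetric e -> irreflexive e ->
  \sum_i energy e (y i) <= (2 * (#|edges e| + k * matching_number e + k./2))%:R.
Proof.
(* Strong induction on nu over all graphs on [V], with the family [y] fixed. *)
have [n] := ubnP (matching_number e); elim: n e => // n IHn e le_n e_sym e_irr.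
have [/existsP [v lt_v]|/existsPn nlt] :=
  boolP [exists v, (matching_number (del_vertex e v) < matching_number e)%N].
  have vA : v \notin [set u | e v u] by rewrite inE e_irr.
  under eq_bigr do rewrite (energy_del_vertex v _ e_sym e_irr).
  rewrite big_split /= -mulr_sumr.
  have := bessel_star vA.
  have := IHn _ (leq_trans lt_v le_n)
    (del_vertex_sym e_sym v) (del_vertex_irr e_irr v).
  set E1 := \sum_i energy _ _; set E2 := \sum_i \sum_(u in _) _ => le1 le2.
  apply: le_trans (_ : (2 * (#|edges (del_vertex e v)|
    + k * matching_number (del_vertex e v) + k./2)
    + 2 * (#|[set u | e v u]| + k))%:R <= _).
    by rewrite natrD; apply: lerD le1 _; rewrite natrM natrD ler_pM2l.
  rewrite ler_nat.
  (* The lost edges pay for the degree of [v], and the drop of nu by at least one pays for the extra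
     [k]. *)
  have arith a b d m m' : (a + d <= b)%N -> (k * m' + k <= k * m)%N ->
      (2 * (a + k * m' + k./2) + 2 * (d + k) <= 2 * (b + k * m + k./2))%N.
    by lia.
  apply: arith; first exact: edges_del_vertex.
  by rewrite -mulnSr leq_mul2l lt_v orbT.
have missed v : avoidable e v v.
  by apply: del_vertex_avoidable; rewrite leqNgt nlt.
have GE := gallai_rel_equiv e_irr missed.
(* Each class serves as its own colour, which puts the relation into the form required by
   [cut_energy]. *)
pose c u := [set v | gallai_rel e u v].
have cE u v : (c u == c v) = gallai_rel e u v.
  apply/eqP/idP => [cuv|uv].
    have : v \in c v by rewrite inE /gallai_rel eqxx.
    by rewrite -cuv inE.
  by apply/setP => w; rewrite !inE; have [_ ->] := GE u v w.
set N := (2 * matching_number e).+1.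
have bound1 : \sum_i energy e (y i) <= (2 * (k * N))%:R.
  have [yk _] := yB.
  rewrite natrM natrM -yk [_ * N%:R]mulrC mulrA mulr_sumr; apply: ler_sum => i _.
  apply: le_trans (_ : energy (fun u v => c u == c v) (y i) <= _).
    apply: energy_le => u v uv; rewrite cE /gallai_rel.
    by rewrite edge_not_avoidable ?orbT.
  apply: cut_energy => u; apply: leq_trans (gallai_class_card e_irr missed u).
  by apply: subset_leq_card; apply/subsetP => v; rewrite !inE cE.
(* There are 2|E| ordered adjacent pairs, and each contributes at most 2 by [bessel_edge]. *)
have bound2 : \sum_i energy e (y i) <= (2 * (2 * #|edges e|))%:R.
  rewrite -handshake // mulnC natrM exchange_big /= natr_sum mulr_suml.
  apply: ler_sum => u _; rewrite exchange_big natr_sum mulr_suml /=.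
  apply: ler_sum => v _; rewrite -mulr_sumr; apply: ler_wpM2l => //.
  case: (eqVneq u v) => [->|/bessel_edge //].
  by rewrite big1 // => i _; rewrite subrr expr0n.
have [le_kN|lt_kN] := leqP (k * N) (2 * #|edges e|).
  by apply: le_trans bound1 _; rewrite ler_nat; rewrite /N in le_kN *; nia.
by apply: le_trans bound2 _; rewrite ler_nat; rewrite /N in lt_kN *; nia.
Qed.

End BesselFamily.

(** * Spectral decomposition and Ky Fan families *)

Section SpectralFamily.
Variables (R : rcfType) (n : nat) (A : 'M[R]_n).
Hypothesis A_sym : A^T = A.
Local Notation f := (real_complex R).
Local Open Scope sesquilinear_scope.

(** The spectral theorem is applied to the complexification [B]: the rows of the unitary [U] are
    orthonormal left eigenvectors, and [d] lists their real eigenvalues, unsorted. *)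
Let B : 'M[R[i]]_n := map_mx f A.
Let U := spectralmx B.
Let d j : R := complex.Re (spectral_diag B 0 j).

(** This splits a Hermitian form with real coefficients into the same form on real and on imaginary
    parts, so that one complex eigenvector becomes two real vectors. *)
Lemma ReZconj (z w : R[i]) (r : R) :
  complex.Re (z * f r * w^*)
    = complex.Re z * r * complex.Re w + complex.Im z * r * complex.Im w.
Proof. by case: z w => [a b] [a' b'] /=; ring. Qed.

Lemma Re_sum (I : finType) (F : I -> R[i]) :
  complex.Re (\sum_i F i) = \sum_i complex.Re (F i).
Proof. by apply: (big_morph (@complex.Re R)) => // -[a b] [c e]. Qed.

Lemma Im_sum (I : finType) (F : I -> R[i]) :
  complex.Im (\sum_i F i) = \sum_i complex.Im (F i).
Proof. by apply: (big_morph (@complex.Im R)) => // -[a b] [c e]. Qed.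

Lemma conj_real_complex x : (f x)^* = f x.
Proof. by rewrite conj_Creal // complex_real. Qed.

Lemma complexified_herm : B \is hermsymmx.
Proof.
apply/is_hermitianmxP; rewrite expr0 scale1r.
by apply/matrixP => i j; rewrite !mxE conj_real_complex -[in LHS]A_sym mxE.
Qed.

Lemma spectral_diagE j : spectral_diag B 0 j = f (d j).
Proof. exact/esym/RRe_real/(mxOverP (hermitian_spectral_diag_real complexified_herm)). Qed.

Lemma complexifiedE : B = invmx U *m diag_mx (spectral_diag B) *m U.
Proof. exact/orthomx_spectralP/hermitian_normalmx/complexified_herm. Qed.

Lemma spectrum_diag : perm_eq (spectrum A) [seq d j | j <- enum 'I_n].
Proof.
apply: perm_spectrum; apply: (map_poly_inj f).
rewrite map_char_poly -/B complexifiedE char_poly_similar;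
  last exact: spectral_unit.
rewrite char_poly_trig ?is_diag_mx_is_trig ?diag_mx_is_diag //.
rewrite rmorph_prod big_map big_enum /=; apply: eq_bigr => i _.
by rewrite map_polyXsubC mxE eqxx mulr1n spectral_diagE.
Qed.

Lemma lambda_sum_subset k : (k <= n)%N -> exists2 J : {set 'I_n}, #|J| = k &
  \sum_(1 <= i < k.+1) lambda A i = \sum_(j in J) d j.
Proof.
move=> kn.
have /tuple_permP [p sp] : perm_eq (spectrum A) [tuple d j | j < n].
  exact: spectrum_diag.
(* The permutation [p] sorts [d]. Since [lambda A i] reads position [i.-1], the indices 1 to [k] are
   the positions below [k]. *)
exists [set p i | i in [set i : 'I_n | (i < k)%N]].
  rewrite card_imset; last exact: perm_inj.
  have := @big_ord_widen _ 0%N addn _ _ (fun=> 1%N) kn.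
  by rewrite sum1_card card_ord sum1dep_card.
rewrite big_imset /=; last by move=> i j _ _; apply: perm_inj.
rewrite big_add1 /= big_mkord (big_ord_widen _ _ kn).
apply: eq_big => [i|i _]; first by rewrite inE.
by rewrite /lambda /= sp -tnth_nth !tnth_mktuple.
Qed.

Lemma spectral_row_normE j : \sum_a (complex.Re (U j a) ^+ 2 + complex.Im (U j a) ^+ 2) = 1.
Proof.
have /unitarymxP /matrixP /(_ j j) := spectral_unitarymx B.
rewrite !mxE eqxx => /(congr1 (@complex.Re R)) /= <-.
rewrite Re_sum; apply: eq_bigr => a _.
by rewrite !mxE -[U j a]mulr1 (ReZconj _ _ 1) mulr1; ring.
Qed.

(** This is the real part of the diagonal entry [j] in [U B U^* = D]. *)
Lemma spectral_row_quadE j :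
  \sum_a \sum_b (complex.Re (U j a) * A a b * complex.Re (U j b)
                 + complex.Im (U j a) * A a b * complex.Im (U j b)) = d j.
Proof.
have Uu := spectral_unitarymx B.
have : U *m B *m U^t* = diag_mx (spectral_diag B).
  rewrite [in LHS]complexifiedE -!mulmxA (unitarymxP Uu) mulmx1 !mulmxA.
  by rewrite mulmxV ?mul1mx // unitarymx_unit.
move=> /matrixP /(_ j j); rewrite !mxE eqxx mulr1n spectral_diagE.
move=> /(congr1 (@complex.Re R)) /= <-; rewrite Re_sum exchange_big /=.
apply: eq_bigr => b _; rewrite !mxE mulr_suml Re_sum; apply: eq_bigr => a _.
by rewrite !mxE ReZconj.
Qed.

(** The unitary [U] preserves the norm of the real vector [b]. *)
Lemma spectral_parseval (b : 'I_n -> R) :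
  \sum_j ((\sum_a complex.Re (U j a) * b a) ^+ 2
          + (\sum_a complex.Im (U j a) * b a) ^+ 2) = \sum_a b a ^+ 2.
Proof.
pose c : 'cV[R[i]]_n := \col_a f (b a).
have /mulmx1C UU := unitarymxP (spectral_unitarymx B).
have : (U *m c)^t* *m (U *m c) = c^t* *m c.
  by rewrite trmx_mul map_mxM -mulmxA [_ *m (U *m c)]mulmxA UU mul1mx.
move=> /matrixP /(_ 0 0); rewrite !mxE => /(congr1 (@complex.Re R)) /=.
rewrite !Re_sum => E.
have normE (z : R[i]) : complex.Re (z^* * z) = complex.Re z ^+ 2 + complex.Im z ^+ 2.
  by case: z => u v /=; ring.
transitivity (\sum_i complex.Re ((c^t*) 0 i * c i 0)).
  rewrite -E; apply: eq_bigr => j _; rewrite [(_ ^t*) 0 j]mxE mxE normE mxE.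
  rewrite Re_sum Im_sum; congr (_ ^+ 2 + _ ^+ 2); apply: eq_bigr => a _;
    by rewrite mxE; case: (U j a) => u v /=; ring.
by apply: eq_bigr => a _; rewrite !mxE normE /=; ring.
Qed.

Lemma lambda_sum_bessel k : (k <= n)%N ->
  exists2 y : 'I_n * bool -> 'I_n -> R, bessel_family k y &
  \sum_(1 <= i < k.+1) lambda A i
    = \sum_p \sum_a \sum_b y p a * A a b * y p b.
Proof.
move=> kn; have [J cJ ->] := lambda_sum_subset kn.
(* The boolean selects the real or the imaginary part of a row of [U]. Rows outside [J] become zero,
   which keeps the index type independent of [J] and turns Parseval into Bessel. *)
pose y (p : 'I_n * bool) a : R :=
  if p.1 \in J then (if p.2 then complex.Re (U p.1 a) else complex.Im (U p.1 a)) else 0.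
have sum_y (G : ('I_n -> R) -> R) : G (fun=> 0) = 0 ->
    \sum_p G (y p) = \sum_(j in J) (G (fun a => complex.Re (U j a))
                                    + G (fun a => complex.Im (U j a))).
  move=> G0; rewrite -(pair_bigA _ (fun j c => G (y (j, c)))) /=.
  rewrite [RHS]big_mkcond; apply: eq_bigr => j _; rewrite big_bool /y /=.
  by case: ifP => // _; rewrite G0 addr0.
exists y; first split.
- rewrite (sum_y (fun x => \sum_v x v ^+ 2)); last first.
    by rewrite big1 // => a _; rewrite expr0n.
  rewrite -cJ -sum1_card natr_sum; apply: eq_bigr => j _.
  by rewrite -(spectral_row_normE j) big_split.
- move=> b; rewrite (sum_y (fun x => (\sum_v x v * b v) ^+ 2)); last first.
    by rewrite big1 ?expr0n // => a _; rewrite mul0r.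
  rewrite -spectral_parseval big_mkcond; apply: ler_sum => j _.
  by case: ifP => // _; rewrite addr_ge0 ?sqr_ge0.
rewrite (sum_y (fun x => \sum_a \sum_b x a * A a b * x b)); last first.
  by rewrite big1 // => a _; rewrite big1 // => b _; rewrite mulr0.
apply: eq_bigr => j _; rewrite -spectral_row_quadE -big_split.
by apply: eq_bigr => a _; rewrite big_split.
Qed.

End SpectralFamily.

(** * The Laplacian quadratic form and the eigenvalue bound *)

Lemma degE (V : finType) (e : rel V) u : deg e u = (\sum_v e u v)%N.
Proof. by rewrite /deg -sum1dep_card big_mkcond; apply: eq_bigr => v _; case: ifP. Qed.

Lemma laplacian_energy (R : numFieldType) (V : finType) (e : rel V)
    (e_sym : symmetric e) (e_irr : irreflexive e) (x : V -> R) :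
  2 * (\sum_i \sum_j x (enum_val i) * laplacian e R i j * x (enum_val j))
    = energy e x.
Proof.
have reindex_V (F : V -> R) : \sum_(i < #|V|) F (enum_val i) = \sum_v F v.
  by rewrite -big_enum_val.
have -> : \sum_i \sum_j x (enum_val i) * laplacian e R i j * x (enum_val j)
    = \sum_u \sum_v ((e u v)%:R * x u ^+ 2 - (e u v)%:R * (x u * x v)).
  rewrite -reindex_V; apply: eq_bigr => i _.
  rewrite sumrB -mulr_suml -natr_sum -degE.
  pose u : V := enum_val i.
  transitivity (\sum_v x u * (if u == v then (deg e u)%:R
                               else if e u v then -1 else 0) * x v).
    by rewrite -[RHS]reindex_V; apply: eq_bigr => j _; rewrite mxE.
  rewrite (bigD1 u) //= eqxx [in RHS](bigD1 u) //= e_irr mul0r add0r -sumrN.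
  congr (_ + _); first ring.
  apply: eq_bigr => v vu; rewrite eq_sym (negPf vu).
  by rewrite -/u; case: (e u v) => /=; ring.
(* Of the two copies of the sum, one has [u] and [v] swapped; together they complete the square
   [(x u - x v)^2]. *)
rewrite mulr_natl mulr2n [X in X + _]exchange_big -big_split /=.
apply: eq_bigr => u _; rewrite -big_split; apply: eq_bigr => v _ /=.
by rewrite [e v u]e_sym; ring.
Qed.

Theorem theorem1p5 (R : realType) (V : finType) (e : rel V)
    (e_sym : symmetric e) (e_irr : irreflexive e) (k : nat)
    (k_ge1 : (1 <= k)%N) (k_leV : (k <= #|V|)%N) :
  \sum_(1 <= i < k.+1) lambda (laplacian e R) i
    <= (#|edges e| + k * matching_number e + k./2)%:R.
Proof.
have [y [yk yb] ->] := lambda_sum_bessel (trmx_laplacian R e_sym) k_leV.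
(* The family is moved from matrix indices to vertices, where the combinatorial bound lives. *)
pose z p v := y p (enum_rank v).
have sumV (F : 'I_#|V| -> R) : \sum_v F (enum_rank v) = \sum_i F i.
  by rewrite [RHS](reindex enum_rank) //; apply/onW_bij/enum_rank_bij.
have zB : bessel_family k z.
  split.
    by rewrite -yk; apply: eq_bigr => p _; apply: (sumV (fun i => y p i ^+ 2)).
  move=> b; have := yb (b \o enum_val).
  rewrite -[leRHS]sumV; under [leRHS]eq_bigr do rewrite /= enum_rankK.
  congr (_ <= _); apply: eq_bigr => p _; congr (_ ^+ 2); rewrite -sumV.
  by apply: eq_bigr => v _; rewrite /= enum_rankK.
have := bessel_energy zB e_sym e_irr; rewrite natrM.
under eq_bigr do rewrite -(laplacian_energy e_sym e_irr).
rewrite -mulr_sumr ler_pM2l ?ltr0n //; congr (_ <= _).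
apply: eq_bigr => p _; apply: eq_bigr => i _; apply: eq_bigr => j _.
by rewrite /z !enum_valK.
Qed.
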